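(* Let $C\subseteq\mathbb{R}^d$ be the attractor of an iterated function system $F=(f_1,\ldots,f_J)$ with contraction rates $\tau_j\in(0,1)$. Let $\tau=\max_{1\leq j\leq J}\tau_j\in(0,1)$ and $D=-\log J/\log\tau>0$. For positive integers $N,n$, let $\mathcal{S}(C,N,n)$ be the set of vectors in $C$ whose entries are real algebraic numbers of degree at most $n$ and height at most $N$. Then $$|\mathcal{S}(C,N,n)|\ll_{C,n}N^{2nD},$$ where the implied constant depends only on $C$ (the iterated function system) and $n$.
   Context: $\mathbb{R}^d$ carries the supremum norm $\Vert\cdot\Vert$. A contraction is a map $f:\mathbb{R}^d\to\mathbb{R}^d$ for which there is $\tau\in(0,1)$ (contraction rate) with $\Vert f(\underline{x})-f(\underline{y})\Vert\leq\tau\Vert\underline{x}-\underline{y}\Vert$ for all $\underline{x},\underline{y}$. An iterated function system (IFS) is a finite set of contractions; its attractor is the unique nonempty compact set $C$ with $\bigcup_{j}f_j(C)=C$. The height $H(\alpha)$ of an algebraic number $\alpha$ is the maximum absolute value of the coefficients of its minimal polynomial over $\mathbb{Z}$ (irreducible, with coprime integer coefficients). *)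

(* Defs.v *)
From HB Require Import structures.
From mathcomp Require Import all_boot all_order all_algebra finmap.
From mathcomp Require Import all_classical all_reals all_analysis.

Set Implicit Arguments.
Unset Strict Implicit.
Unset Printing Implicit Defensive.

Import Order.TTheory GRing.Theory Num.Theory.
Import numFieldNormedType.Exports.

Local Open Scope classical_set_scope.
Local Open Scope ring_scope.

(* The norm on 'rV[R]_d is MathComp-Analysis's [mx_norm], i.e. the supremum
   norm. *)
Definition contraction_with_rate (R : realType) (d : nat) (t : R)
    (f : 'rV[R]_d -> 'rV[R]_d) : Prop :=
  0 < t < 1 /\ forall x y : 'rV[R]_d, `|f x - f y| <= t * `|x - y|.

(* Hutchinson's theorem says that a system of contractions has exactly one
   attractor in this sense. *)
Definition is_attractor (R : realType) (d J : nat)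
    (f : 'I_J -> 'rV[R]_d -> 'rV[R]_d) (C : set 'rV[R]_d) : Prop :=
  [/\ C !=set0, compact C & \bigcup_(j in [set: 'I_J]) (f j @` C) = C].

(* [zcontents p] is the gcd of the coefficients of [p], carrying the sign of
   the leading coefficient: [zcontents p = 1] says that the coefficients are
   coprime and fixes the sign of the minimal polynomial. [irreducible_poly]
   ignores constant factors, which the condition on [zcontents] rules out, so
   the two together say that [p] is nonconstant and irreducible in Z[X]. *)
Definition is_minpolyZ (R : realType) (x : R) (p : {poly int}) : Prop :=
  [/\ irreducible_poly p, zcontents p = 1 & root (map_poly intr p : {poly R}) x].

Definition algebraic (R : realType) (x : R) : Prop :=
  algebraicOver (ratr : rat -> R) x.

(* The junk value 0 is taken only when x is transcendental. *)
Definition minpolyZ (R : realType) (x : R) : {poly int} :=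
  xget 0 [set p : {poly int} | is_minpolyZ x p].

Definition alg_degree (R : realType) (x : R) : nat := (size (minpolyZ x)).-1.

Definition alg_height (R : realType) (x : R) : nat :=
  (\max_(i < size (minpolyZ x)) absz ((minpolyZ x)`_i)%R)%N.

Definition alg_points (R : realType) (d : nat) (C : set 'rV[R]_d) (N n : nat) :
    set 'rV[R]_d :=
  [set x | C x /\ forall i : 'I_d,
     [/\ algebraic (x ord0 i), (alg_degree (x ord0 i) <= n)%N
       & (alg_height (x ord0 i) <= N)%N]].

(* Main.v *)
Require Import Defs.
From HB Require Import structures.
From mathcomp Require Import all_boot all_order all_algebra finmap.
From mathcomp Require Import all_classical all_reals all_analysis.
From mathcomp Require Import perm zify ring.

Set Implicit Arguments.
Unset Strict Implicit.
Unset Printing Implicit Defensive.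

Import Order.TTheory GRing.Theory Num.Theory.
Import numFieldNormedType.Exports.

Local Open Scope classical_set_scope.
Local Open Scope ring_scope.

(* Iterating the system covers C by J^k cells of diameter at most taumax^k times
   the diameter of C. The resultant of two distinct minimal polynomials of degree
   at most n and height at most N is a nonzero integer, and Cramer's rule on the
   Sylvester matrix bounds it by a constant times N^(2n) |x - y| for roots x, y
   of the two polynomials in a bounded set. Hence, when taumax^k is a small
   multiple of N^(-2n), corresponding coordinates of two points of one cell share
   their minimal polynomial, each cell contains at most n^d points, and the least
   such k gives J^k << N^(2nD). Sharing a minimal polynomial costs only a
   bounded factor, so no bound on the separation of conjugates is needed. *)

(** * Bounds for determinants, resultants and polynomial values *)

Lemma norm_det_le (R : numDomainType) (m : nat) (A : 'M[R]_m) (B : R) :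
  (forall i j, `|A i j| <= B) -> `|\det A| <= m`!%:R * B ^+ m.
Proof.
move=> AB; rewrite /determinant; apply: le_trans (ler_norm_sum _ _ _) _.
have -> : m`!%:R * B ^+ m = \sum_(s : 'S_m) B ^+ m.
  by rewrite sumr_const card_Sn mulr_natl.
apply: ler_sum => s _; rewrite normrM normrX normrN1 expr1n mul1r normr_prod.
have -> : B ^+ m = \prod_(i < m) B by rewrite prodr_const card_ord.
apply: ler_prod => i _.
by rewrite normr_ge0 AB.
Qed.

Lemma norm_cofactor_le (R : numDomainType) (m : nat) (A : 'M[R]_m) (B : R) i j :
  (forall i j, `|A i j| <= B) -> `|cofactor A i j| <= m.-1`!%:R * B ^+ m.-1.
Proof.
move=> AB; rewrite normrM normrX normrN1 expr1n mul1r.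
by apply: norm_det_le => k l; rewrite !mxE.
Qed.

(** Each row of the Sylvester matrix lists the coefficients of a shift ['X^k * p] or ['X^k * q], so
    pairing it with the powers of [x] evaluates that shift at [x]. *)
Lemma mul_Sylvester_powers (R : comNzRingType) (p q : {poly R}) (x : R)
    (i : 'I_((size q).-1 + (size p).-1)) :
  (1 < size p)%N -> (1 < size q)%N ->
  \sum_j Sylvester_mx p q i j * x ^+ j =
  match fintype.split i with inl k => x ^+ k * p.[x] | inr k => x ^+ k * q.[x] end.
Proof.
move=> p_nc q_nc.
have row (r : {poly R}) k : (k + size r <= (size q).-1 + (size p).-1)%N ->
    \sum_(j < (size q).-1 + (size p).-1) (r`_(j - k) *+ (k <= j)%N) * x ^+ j =
    x ^+ k * r.[x].
  move=> kr; have sz : (size ('X^k * r)%R <= (size q).-1 + (size p).-1)%N.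
    apply: leq_trans kr; apply: leq_trans (size_polyMleq _ _) _.
    by rewrite size_polyXn.
  transitivity ('X^k * r).[x].
    rewrite (horner_coef_wide _ sz); apply: eq_bigr => j _.
    by rewrite coefXnM ltnNge if_neg -mulrb.
  by rewrite hornerM hornerXn.
under eq_bigr do rewrite Sylvester_mxE.
case: (fintype.split i) => k; apply: row.
  by rewrite -(ltn_predK p_nc) addnS -addSn leq_add2r.
by rewrite -{1}(ltn_predK q_nc) addnS addnC -addnS leq_add2l.
Qed.

(* Cramer's rule applied to the product of the Sylvester matrix with the column of
   powers of [x], in which only multiples of [q.[x]] survive. *)
Lemma norm_resultant_le (R : numDomainType) (p q : {poly R}) (x B M : R)
    (m := ((size q).-1 + (size p).-1)%N) :
  (1 < size p)%N -> (1 < size q)%N ->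
  (forall i, `|p`_i| <= B) -> (forall i, `|q`_i| <= B) ->
  1 <= M -> `|x| <= M -> root p x ->
  `|resultant p q| <= m`!%:R * B ^+ m.-1 * M ^+ m * `|q.[x]|.
Proof.
move=> p_nc q_nc pB qB M1 xM /rootP px0.
have m_gt0 : (0 < m)%N by rewrite /m -(subnKC q_nc).
have B0 : 0 <= B by apply: le_trans (pB 0%N).
have M0 : 0 <= M by apply: le_trans M1.
pose j0 := Ordinal m_gt0; pose S := Sylvester_mx p q.
have SB i j : `|S i j| <= B.
  by rewrite Sylvester_mxE; case: (fintype.split i) => k; case: (_ <= _)%N;
    rewrite ?mulr1n ?mulr0n ?normr0 ?pB ?qB.
pose v : 'cV[R]_m := \col_j x ^+ j.
(* Entry 0 of [v] is [x ^+ 0 = 1], so entry 0 of [\adj S *m S *m v] is the determinant itself. *)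
have -> : resultant p q = \sum_(i < m) cofactor S i j0 * (S *m v) i 0.
  rewrite /resultant -/S; have := congr1 (fun A : 'cV_m => A j0 0) (mulmxA (\adj S) S v).
  rewrite mul_adj_mx mul_scalar_mx 2!mxE /= [in X in _ = X -> _]mxE expr0 mulr1 => <-.
  by apply: eq_bigr => i _; rewrite mxE.
apply: le_trans (ler_norm_sum _ _ _) _.
have -> : m`!%:R * B ^+ m.-1 * M ^+ m * `|q.[x]| =
          \sum_(i < m) m.-1`!%:R * B ^+ m.-1 * (M ^+ m * `|q.[x]|).
  rewrite sumr_const card_ord -{1}(prednK m_gt0) factS natrM prednK //.
  by rewrite -!mulrA mulr_natl.
apply: ler_sum => i _; rewrite normrM ler_pM // ?norm_cofactor_le //.
have -> : (S *m v) i 0 = \sum_j S i j * x ^+ j.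
  by rewrite mxE; apply: eq_bigr => j _; rewrite [v _ _]mxE.
rewrite mul_Sylvester_powers // px0.
case: (fintype.split i) => k; first by rewrite mulr0 normr0 mulr_ge0 ?exprn_ge0.
rewrite normrM normrX ler_wpM2r //.
apply: (@le_trans _ _ (M ^+ k)); first by rewrite lerXn2r ?nnegrE.
by rewrite ler_weXn2l // ltnW // (leq_trans (ltn_ord k)) // leq_addl.
Qed.

Lemma horner_lipschitz (R : numDomainType) (q : {poly R}) (x y B M : R) :
  (forall i, `|q`_i| <= B) -> 1 <= M -> `|x| <= M -> `|y| <= M ->
  `|q.[x] - q.[y]| <= (size q ^ 2)%:R * B * M ^+ (size q) * `|x - y|.
Proof.
move=> qB M1 xM yM; have B0 : 0 <= B by apply: le_trans (qB 0%N).
have M0 : 0 <= M by apply: le_trans M1.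
rewrite !horner_coef -sumrB; apply: le_trans (ler_norm_sum _ _ _) _.
have -> : (size q ^ 2)%:R * B * M ^+ (size q) * `|x - y| =
    \sum_(i < size q) B * ((size q)%:R * M ^+ (size q) * `|x - y|).
  by rewrite sumr_const card_ord natrX -[RHS]mulr_natl; ring.
apply: ler_sum => i _; rewrite -mulrBr normrM ler_pM // subrXX normrM mulrC.
apply: ler_wpM2r => //; apply: le_trans (ler_norm_sum _ _ _) _.
(* In the factorization of [x ^+ i - y ^+ i] by [x - y], every term of the cofactor has total degree
   below [size q]; as [1 <= M], one power of [M] bounds them all. *)
apply: (@le_trans _ _ (\sum_(j < i) M ^+ (size q))).
  apply: ler_sum => j _; rewrite normrM !normrX.
  apply: (@le_trans _ _ (M ^+ (i.-1 - j) * M ^+ j)).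
    by apply: ler_pM; rewrite ?exprn_ge0 // lerXn2r ?nnegrE.
  by rewrite -exprD ler_weXn2l //; have := ltn_ord i; have := ltn_ord j; lia.
rewrite sumr_const card_ord -[X in X <= _]mulr_natl ler_wpM2r ?exprn_ge0 // ler_nat.
by rewrite ltnW.
Qed.

(** * Separation of roots of distinct minimal polynomials *)

(** A vanishing resultant gives a nonconstant gcd, which by irreducibility is associate to both [p]
    and [q]. So [a *: p = b *: q], and comparing signed contents yields [a = b]. *)
Lemma resultant_neq0 (p q : {poly int}) :
  irreducible_poly p -> irreducible_poly q ->
  zcontents p = 1 -> zcontents q = 1 -> p != q -> resultant p q != 0.
Proof.
move=> [_ ip] [_ iq] cp cq; apply: contraNneq => /eqP; rewrite resultant_eq0 => g1.
have gn1 : size (gcdp p q) != 1%N by rewrite gtn_eqF.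
have /eqpP [[a b] /= /andP [a0 b0] e] : (p %= q)%R.
  have e1 : (gcdp p q %= p)%R by apply: ip; rewrite ?dvdp_gcdl.
  have e2 : (gcdp p q %= q)%R by apply: iq; rewrite ?dvdp_gcdr.
  by apply: eqp_trans e2; rewrite eqp_sym.
have := congr1 zcontents e; rewrite !zcontentsZ cp cq !mulr1 => ab.
have aP0 : a%:P != 0 by rewrite polyC_eq0.
by apply/eqP/(mulfI aP0); rewrite !mul_polyC e ab.
Qed.

(* The [map_resultant] of [mxpoly] only covers morphisms out of a polynomial ring. *)
Lemma map_resultant_int (R : numDomainType) (p q : {poly int}) :
  resultant (map_poly intr p) (map_poly intr q) = (resultant p q)%:~R :> R.
Proof.
have int_inj : injective (intr : int -> R) by exact: intr_inj.
rewrite /resultant /Sylvester_mx !size_map_inj_poly //.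
rewrite -det_map_mx /= map_col_mx; congr (\det (col_mx _ _)); apply/esym;
  by apply: map_lin1_mx => v; rewrite map_poly_rV rmorphM /= map_rVpoly.
Qed.

(** The resultant is a nonzero integer, hence at least 1 in absolute value, while it is bounded by a
    multiple of [q.[x] = q.[x] - q.[y]], which the Lipschitz estimate controls by [x - y]. *)
Lemma root_separation (R : numDomainType) (p q : {poly int}) (x y M : R) (N n : nat) :
  irreducible_poly p -> irreducible_poly q ->
  zcontents p = 1 -> zcontents q = 1 -> p != q ->
  ((size p).-1 <= n)%N -> ((size q).-1 <= n)%N ->
  (forall i, (absz (p`_i)%R <= N)%N) -> (forall i, (absz (q`_i)%R <= N)%N) ->
  (0 < N)%N -> 1 <= M -> `|x| <= M -> `|y| <= M ->
  root (map_poly intr p) x -> root (map_poly intr q) y ->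
  1 <= (2 * n)`!%:R * (n.+1 ^ 2)%:R * M ^+ (2 * n + n.+1) * N%:R ^+ (2 * n) *
       `|x - y|.
Proof.
move=> ip iq cp cq pq sp sq pN qN N0 M1 xM yM px /rootP qy.
have M0 : 0 <= M by apply: le_trans M1.
have int_inj : injective (intr : int -> R) by exact: intr_inj.
have szE (r : {poly int}) : size (map_poly intr r : {poly R}) = size r.
  by rewrite size_map_inj_poly.
have coefB (r : {poly int}) : (forall i, (absz (r`_i)%R <= N)%N) ->
    forall i, `|(map_poly intr r : {poly R})`_i| <= N%:R.
  by move=> rN i; rewrite coef_map /= -intr_norm -abszE -pmulrn ler_nat.
have [[p1 _] [q1 _]] := (ip, iq).
have r0 := resultant_neq0 ip iq cp cq pq.
set m := ((size q).-1 + (size p).-1)%N.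
have m_gt0 : (0 < m)%N by rewrite /m -(subnKC q1).
have mn : (m <= 2 * n)%N by rewrite /m mul2n -addnn leq_add.
have step : 1 <= m`!%:R * N%:R ^+ m.-1 * M ^+ m * `|(map_poly intr q).[x]|.
  have := norm_resultant_le _ _ (coefB _ pN) (coefB _ qN) M1 xM px.
  rewrite !szE => /(_ p1 q1); apply: le_trans.
  by rewrite map_resultant_int -intr_norm (ler_int _ 1) -gtz0_ge1 normr_gt0.
apply: (le_trans step).
have lip : `|(map_poly intr q).[x]| <= (n.+1 ^ 2)%:R * N%:R * M ^+ n.+1 * `|x - y|.
  have := horner_lipschitz (coefB _ qN) M1 xM yM; rewrite szE qy subr0 => /le_trans.
  have sqn : (size q <= n.+1)%N by rewrite -(prednK (ltnW q1)).
  apply; rewrite ler_wpM2r // ler_pM ?exprn_ge0 ?mulr_ge0 ?ler0n // ?ler_weXn2l //.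
  by rewrite ler_wpM2r ?ler0n // ler_nat leq_exp2r.
apply: (@le_trans _ _ ((2 * n)`!%:R * N%:R ^+ m.-1 * M ^+ (2 * n) *
   ((n.+1 ^ 2)%:R * N%:R * M ^+ n.+1 * `|x - y|))).
  apply: ler_pM => //; first by rewrite !mulr_ge0 ?exprn_ge0 ?ler0n.
  rewrite ler_pM ?exprn_ge0 ?mulr_ge0 ?ler0n ?exprn_ge0 ?ler0n ?ler_weXn2l //.
  by rewrite ler_wpM2r ?exprn_ge0 ?ler0n // ler_nat leq_fact.
(* The cofactors contribute [m.-1] factors [N] and the Lipschitz constant one more; the total [m] is
   at most [2 * n]. *)
have -> : (2 * n)`!%:R * N%:R ^+ m.-1 * M ^+ (2 * n) *
   ((n.+1 ^ 2)%:R * N%:R * M ^+ n.+1 * `|x - y|) =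
   (2 * n)`!%:R * (n.+1 ^ 2)%:R * M ^+ (2 * n + n.+1) * N%:R ^+ m * `|x - y| :> R.
  have -> : N%:R ^+ m = N%:R * N%:R ^+ m.-1 :> R by rewrite -exprS prednK.
  rewrite exprD; set a := _`!%:R; set b := (_ ^ 2)%:R; set u := _ ^+ (2 * n).
  set v := _ ^+ n.+1; set w := _ ^+ m.-1; ring.
rewrite ler_wpM2r // ler_wpM2l ?ler_weXn2l ?ler1n //.
by rewrite !mulr_ge0 ?exprn_ge0 ?ler0n.
Qed.

(** * Roots and integer minimal polynomials *)

Lemma poly_roots_seq (R : idomainType) (p : {poly R}) : p != 0 ->
  exists2 s : seq R, (size s <= (size p).-1)%N & forall x, root p x -> x \in s.
Proof.
have [k] := ubnP (size p); elim: k p => // k IH p pk p0.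
have [[a pa]|nr] := pselect (exists a, root p a); last first.
  by exists [::] => // x px; case: nr; exists x.
have /factor_theorem [q pE] := pa.
have q0 : q != 0 by apply: contraNneq p0 => q0; rewrite pE q0 mul0r.
have szp : size p = (size q).+1 by rewrite pE size_Mmonic ?monicXsubC // size_XsubC addn2.
have [|s ss sr] := IH q _ q0; first by rewrite szp in pk.
exists (a :: s); first by rewrite szp /= -(prednK (_ : 0 < size q)%N) ?size_poly_gt0.
move=> x; rewrite pE rootM root_XsubC inE => /orP[/sr ->|->] //.
by rewrite orbT.
Qed.

(** The witness is the primitive part of a nonzero integer polynomial of least size vanishing at
    [x]; one exists by clearing denominators in a rational annihilator. *)
Lemma minpolyZP (R : realType) (x : R) :
  Defs.algebraic x -> is_minpolyZ x (minpolyZ x).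
Proof.
move=> [p p0 px]; apply: (@xgetPex _ _ [set p | is_minpolyZ x p]).
have int_inj : injective (intr : int -> R) by exact: intr_inj.
have [q [a a0 pE]] := rat_poly_scale p.
pose T k := `[< exists r : {poly int},
  [/\ r != 0, size r = k & root (map_poly intr r : {poly R}) x] >].
have /ex_minnP[k /asboolP[r [r0 rk rx]] kmin] : exists k, T k.
  exists (size q); apply/asboolP; exists q; split => //.
    by apply: contraNneq p0 => q0; rewrite pE q0 map_poly0 scaler0.
  move: px; rewrite pE map_polyZ /= rootZ ?fmorph_eq0 ?invr_eq0 ?intr_eq0 //.
  congr (root _ x); rewrite -map_poly_comp; apply: eq_map_poly => z /=.
  by rewrite ratr_int.
have size_min s : s != 0 -> root (map_poly intr s : {poly R}) x ->
    (size r <= size s)%N.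
  by move=> s0 sx; rewrite rk; apply: kmin; apply/asboolP; exists s.
exists (zprimitive r); split; last first.
- move: rx; rewrite {1}[r]zpolyEprim map_polyZ rootZ //.
  by rewrite intr_eq0 zcontents_eq0.
- by rewrite zcontents_primitive r0.
split.
  rewrite size_zprimitive ltnNge; apply/negP => /size1_polyC rE.
  move: rx r0; rewrite rE map_polyC rootC intr_eq0 => /eqP ->.
  by rewrite eqxx.
move=> d dn1 dr.
have /dvdp_size_eqp <- := dr; rewrite eqn_leq dvdp_leq ?zprimitive_eq0 //=.
(* Divisibility holds up to a constant: [c *: zprimitive r = s * d]. One of [s], [d] vanishes at
   [x]. It cannot be [s], which is smaller than [r] because [d] is nonconstant; so it is [d], and
   minimality bounds [size r] by [size d]. *)
have [[c s] /= c0 cE] := Pdiv.Idomain.dvdpP _ _ dr.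
have cr0 : c *: zprimitive r != 0.
  by rewrite -size_poly_eq0 size_scale // size_zprimitive size_poly_eq0.
have d0 : d != 0 by apply: contraNneq cr0 => d0; rewrite cE d0 mulr0.
have s0 : s != 0 by apply: contraNneq cr0 => s0; rewrite cE s0 mul0r.
rewrite size_zprimitive; apply: (size_min d) => //.
have : root (map_poly intr (c *: zprimitive r) : {poly R}) x.
  move: rx; rewrite {1}[r]zpolyEprim !map_polyZ !rootZ ?intr_eq0 ?zcontents_eq0 //.
rewrite cE rmorphM rootM => /orP[sx|//].
have := congr1 (fun p : {poly int} => size p) cE.
rewrite size_scale // size_zprimitive size_mul // => szE.
have d1 : (1 < size d)%N by rewrite ltn_neqAle eq_sym dn1 size_poly_gt0.
have := size_min _ s0 sx; rewrite szE -(ltn_predK d1) addnS /=.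
by rewrite -[leqRHS]addn0 leq_add2l leqNgt -ltnS (ltn_predK d1) d1.
Qed.

Lemma absz_coef_minpolyZ (R : realType) (x : R) (i : nat) :
  (absz ((minpolyZ x)`_i)%R <= alg_height x)%N.
Proof.
have [ix|xi] := ltnP i (size (minpolyZ x)); last by rewrite nth_default.
exact: (leq_bigmax (Ordinal ix)).
Qed.

(** * Encoding points by cells and root indices *)

Lemma norm_entry_le (R : realType) (d : nat) (x : 'rV[R]_d) (i : 'I_d) :
  `|x ord0 i| <= `|x|.
Proof.
rewrite [leRHS]mx_normrE.
exact: (le_bigmax _ (fun ij : 'I_1 * 'I_d => `|x ij.1 ij.2|) (ord0, i)).
Qed.

Lemma card_fset_set_inj (T : choiceType) (F : finType) (A : set T) (g : T -> F) :
  (forall x y, A x -> A y -> g x = g y -> x = y) ->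
  finite_set A /\ (#|` fset_set A| <= #|F|)%N.
Proof.
move=> g_inj; have [->|/set0P[x0 Ax0]] := eqVneq A set0.
  by rewrite fset_set0 cardfs0; split => //; exact: finite_set0.
pose h c := xget x0 [set x | A x /\ g x = c].
have hg x : A x -> h (g x) = x.
  by move=> Ax; apply: xget_unique => // y [Ay gy]; exact: g_inj.
have Ah x : A x -> x \in map h (enum F).
  by move=> Ax; rewrite -(hg x Ax) map_f // mem_enum.
have fA : finite_set A by apply: sub_finite_set (finite_seq (map h (enum F))).
split => //; rewrite cardE -(size_map h); apply: uniq_leq_size => // x.
by rewrite in_fset_set // inE => /Ah.
Qed.

(** Unfolding the invariance of [C] under the system [k] times places [x] in the cell of some word
    of length [k]. *)
Lemma attractor_word (R : realType) (d J : nat) (f : 'I_J -> 'rV[R]_d -> 'rV[R]_d)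
    (C : set 'rV[R]_d) (k : nat) (x : 'rV[R]_d) : is_attractor f C -> C x ->
  exists w : k.-tuple 'I_J, exists2 y, C y & x = foldr f y w.
Proof.
move=> [_ _ fC]; elim: k x => [|k IH] x Cx; first by exists [tuple], x.
move: (Cx); rewrite -{1}fC => -[j _ [y Cy <-]].
have [w [z Cz ->]] := IH _ Cy.
by exists [tuple of j :: w], z.
Qed.

Lemma foldr_contraction (R : realType) (d J : nat) (f : 'I_J -> 'rV[R]_d -> 'rV[R]_d)
    (t : R) (w : seq 'I_J) (y z : 'rV[R]_d) :
  0 <= t -> (forall j u v, `|f j u - f j v| <= t * `|u - v|) ->
  `|foldr f y w - foldr f z w| <= t ^+ size w * `|y - z|.
Proof.
move=> t0 ft; elim: w => [|j w IH] /=; first by rewrite expr0 mul1r.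
by apply: le_trans (ft _ _ _) _; rewrite exprS -mulrA ler_wpM2l.
Qed.

(** A point is encoded by the word of its cell and, for each coordinate, an index in a list of the
    roots of its minimal polynomial. The smallness hypothesis makes the minimal polynomials agree
    within a cell, so the code is injective; there are [J ^ k * n ^ d] codes. *)
Lemma alg_points_card (R : realType) (d J : nat)
    (f : 'I_J -> 'rV[R]_d -> 'rV[R]_d) (C : set 'rV[R]_d) (t M : R) (N n k : nat) (hJ : (0 < J)%N) :
  is_attractor f C -> 0 <= t ->
  (forall j u v, `|f j u - f j v| <= t * `|u - v|) ->
  1 <= M -> (forall x, C x -> `|x| <= M) -> (0 < N)%N -> (0 < n)%N ->
  (2 * n)`!%:R * (n.+1 ^ 2)%:R * M ^+ (2 * n + n.+1) * N%:R ^+ (2 * n) *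
    (t ^+ k * (2 * M)) < 1 ->
  finite_set (alg_points C N n) /\
  (#|` fset_set (alg_points C N n)| <= J ^ k * n ^ d)%N.
Proof.
move=> hC t0 ft M1 CM N0; case: n => // n _ small.
have M0 : 0 <= M by apply: le_trans M1.
have /choice [w wP] : forall x, exists w : k.-tuple 'I_J,
    C x -> exists2 y, C y & x = foldr f y w.
  move=> x; have [Cx|nC] := pselect (C x).
    by have [w wx] := attractor_word k hC Cx; exists w.
  (* Outside [C] the word is arbitrary; [0 < J] provides a letter. *)
  by exists (nseq_tuple k (Ordinal hJ)) => /nC.
have /choice [s sP] : forall p : {poly int}, exists s : seq R, p != 0 ->
    (size s <= (size p).-1)%N /\ forall x, root (map_poly intr p) x -> x \in s.
  move=> p; have [->|p0] := eqVneq p 0; first by exists [::].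
  have szE : size (map_poly intr p : {poly R}) = size p.
    by rewrite size_map_inj_poly //; exact: intr_inj.
  have [|s ss sr] := @poly_roots_seq _ (map_poly intr p : {poly R}).
    by rewrite -size_poly_eq0 szE size_poly_eq0.
  by exists s; rewrite -szE.
pose g x := (w x, [ffun i : 'I_d =>
  inord (index (x ord0 i) (s (minpolyZ (x ord0 i)))) : 'I_n.+1]).
have := @card_fset_set_inj _ _ (alg_points C N n.+1) g.
rewrite card_prod card_tuple card_ffun !card_ord; apply.
move=> x y [Cx xP] [Cy yP] [wxy /ffunP ixy]; apply/rowP => i.
have [xa xd xh] := xP i; have [ya yd yh] := yP i.
have [xi xc xr] := minpolyZP xa; have [yi yc yr] := minpolyZP ya.
have min0 (p : {poly int}) : irreducible_poly p -> p != 0.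
  by case=> p1 _; rewrite -size_poly_gt0 ltnW.
have pxy : minpolyZ (x ord0 i) = minpolyZ (y ord0 i).
  (* Distinct minimal polynomials would, by root separation, force the quantity in [small] to be at
     least 1, since points with the same word are within [t ^+ k * (2 * M)]. *)
  apply/eqP; apply: contraPT small => pxy.
  apply/negP; rewrite -leNgt.
  have xM : `|x ord0 i| <= M by apply: le_trans (norm_entry_le _ _) (CM _ Cx).
  have yM : `|y ord0 i| <= M by apply: le_trans (norm_entry_le _ _) (CM _ Cy).
  apply: le_trans (root_separation xi yi xc yc pxy xd yd _ _ N0 M1 xM yM xr yr) _.
  - by move=> j; apply: leq_trans (absz_coef_minpolyZ _ _) xh.
  - by move=> j; apply: leq_trans (absz_coef_minpolyZ _ _) yh.
  rewrite ler_wpM2l ?mulr_ge0 ?exprn_ge0 ?ler0n //.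
  have [x' Cx' xE] := wP _ Cx; have [y' Cy' yE] := wP _ Cy.
  have -> : x ord0 i - y ord0 i = (x - y) ord0 i by rewrite !mxE.
  apply: le_trans (norm_entry_le _ _) _.
  rewrite xE yE -wxy; apply: le_trans (foldr_contraction _ _ _ t0 ft) _.
  rewrite size_tuple ler_wpM2l ?exprn_ge0 //.
  by apply: le_trans (ler_normB _ _) _; rewrite mulr2n mulrDl mul1r lerD ?CM.
have [sx xs] := sP _ (min0 _ xi); have [sy ys] := sP _ (min0 _ yi).
have lt_index u : u \in s (minpolyZ (y ord0 i)) ->
    (index u (s (minpolyZ (y ord0 i))) < n.+1)%N.
  by rewrite -index_mem => /leq_trans; apply; exact: leq_trans sy yd.
move: (ixy i); rewrite !ffunE => /(congr1 val) /=; rewrite pxy.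
rewrite pxy in xr xs.
rewrite !inordK ?lt_index ?ys //.
by move=> /(congr1 (nth 0 (s (minpolyZ (y ord0 i))))); rewrite !nth_index ?ys.
Qed.

(** * Choice of the depth and of the constant *)

Theorem theorem4p2 (R : realType) (d J : nat) (hJ : (0 < J)%N)
    (f : 'I_J -> 'rV[R]_d -> 'rV[R]_d) (tau : 'I_J -> R)
    (hf : forall j : 'I_J, contraction_with_rate (tau j) (f j))
    (C : set 'rV[R]_d) (hC : is_attractor f C) (n : nat) (hn : (0 < n)%N) :
  let taumax : R := \big[Num.max/0]_(j < J) tau j in
  let D : R := - ln (J%:R : R) / ln taumax in
  exists2 c : R, 0 < c &
    forall N : nat, (0 < N)%N ->
      finite_set (alg_points C N n) /\
      (#|` fset_set (alg_points C N n)|)%:R <= c * (N%:R `^ (2 * n%:R * D)).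
Proof.
set t := \big[Num.max/0]_(j < J) tau j => /=.
set D := - ln _ / ln t.
have tau_le j : tau j <= t by exact: (le_bigmax _ tau j).
have t_gt0 : 0 < t.
  by apply: lt_le_trans (tau_le (Ordinal hJ)); have [/andP[]] := hf (Ordinal hJ).
have t_lt1 : t < 1 by apply: bigmax_lt => // j _; have [/andP[]] := hf j.
have ft j u v : `|f j u - f j v| <= t * `|u - v|.
  by have [_ fj] := hf j; apply: le_trans (fj u v) _; rewrite ler_wpM2r.
have [M M1 CM] : exists2 M : R, 1 <= M & forall x, C x -> `|x| <= M.
  have [_ /compact_bounded[M0 [_ CM0]] _] := hC.
  exists (`|M0| + 1); first by rewrite lerDr.
  by apply: CM0; rewrite ltr_pwDr // ler_norm.
have M0 : 0 <= M by apply: le_trans M1.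
have lnt : ln t < 0 by rewrite ln_lt0 // t_gt0.
have D_ge0 : 0 <= D.
  by rewrite /D mulNr -mulrN mulr_ge0 ?ln_ge0 ?ler1n // oppr_ge0 invr_le0 ltW.
(* The defining property of [D]: it converts the number of cells into a power of the contraction. *)
have JE : (t^-1) `^ D = J%:R.
  rewrite /powR invr_eq0 gt_eqF // lnV ?posrE // /D mulrN divfK ?lt_eqF // opprK.
  by rewrite lnK // posrE ltr0n.
(* [a] gathers the factors of the smallness condition that depend neither on [N] nor on [k]; [2 * M]
   bounds the diameter of [C]. *)
pose a : R := (2 * n)`!%:R * (n.+1 ^ 2)%:R * M ^+ (2 * n + n.+1) * (2 * M).
have a1 : 1 < a.
  have -> : a = 2 * ((2 * n)`!%:R * (n.+1 ^ 2)%:R * M ^+ (2 * n + n.+1) * M).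
    by rewrite /a; ring.
  apply: (@lt_le_trans _ _ (2 * 1)); first by rewrite mulr1 ltr1n.
  by rewrite ler_wpM2l // !mulr_ege1 ?exprn_ege1 // ler1n ?fact_gt0.
have a0 : 0 < a by apply: lt_trans a1.
(* [n ^ d] counts the points in a cell, [J] pays for the last subdivision, and [a] to the power [D]
   comes from bounding [J ^ k.-1] by [b] to the power [D]. *)
exists ((n ^ d)%:R * J%:R * a `^ D).
  by rewrite !mulr_gt0 ?powR_gt0 // ltr0n ?expn_gt0 ?hn.
move=> N N0; pose b : R := a * N%:R ^+ (2 * n).
have b1 : 1 < b.
  by apply: (lt_le_trans a1); rewrite ler_peMr ?exprn_ege1 ?ler1n // ltW.
have b0 : 0 < b by apply: lt_trans b1.
(* The least depth at which the smallness condition [b * t ^+ k < 1] holds. *)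
have /ex_minnP[k bk kmin] : exists k, t ^+ k < b^-1.
  have t1 : `|t| < 1 by rewrite ger0_norm // ltW.
  have /cvgr0Pnorm_lt /(_ b^-1) := cvg_expr t1.
  rewrite invr_gt0 => /(_ b0) [k _ /(_ k (leqnn k))].
  rewrite /= ger0_norm ?exprn_ge0 ?ltW // => tk.
  by exists k.
have [| fin card] := alg_points_card hJ hC (ltW t_gt0) ft M1 CM (k := k) N0 hn.
  have -> : (2 * n)`!%:R * (n.+1 ^ 2)%:R * M ^+ (2 * n + n.+1) * N%:R ^+ (2 * n) *
    (t ^+ k * (2 * M)) = b * t ^+ k by rewrite /b /a; ring.
  by rewrite mulrC -ltr_pdivlMr // mul1r.
split => //.
apply: (@le_trans _ _ (J ^ k * n ^ d)%:R); first by rewrite ler_nat.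
have -> : (n ^ d)%:R * J%:R * a `^ D * N%:R `^ (2 * n%:R * D) =
    J%:R * b `^ D * (n ^ d)%:R.
  rewrite (powRM _ (ltW a0)) ?exprn_ge0 ?ler0n // -powR_mulrn ?ler0n // -powRrM.
  by rewrite natrM; ring.
rewrite natrM ler_wpM2r ?ler0n //.
(* Depth 0 is impossible because [1 < b]. Otherwise the previous depth fails the condition, so
   [t^-1 ^+ k <= b]; raising this to the power [D >= 0] bounds [J ^ k]. *)
case: k => [|k] in bk kmin card *.
  by move: bk; rewrite expr0 ltNge ltW // invf_lt1.
rewrite expnS natrM ler_wpM2l ?ler0n // natrX -JE.
rewrite -powR_mulrn ?powR_ge0 // -powRrM mulrC powRrM.
rewrite powR_mulrn ?invr_ge0 ?(ltW t_gt0) //.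
apply: ge0_ler_powR; rewrite ?nnegrE ?exprn_ge0 ?invr_ge0 ?(ltW t_gt0) ?(ltW b0) //.
rewrite exprVn invf_ple ?posrE ?exprn_gt0 // leNgt.
by apply/negP => /kmin; rewrite ltnn.
Qed.
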